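(* A power of an $(m,\infty)$-isometry is not necessarily an $(m,\infty)$-isometry: there exist $m \in \mathbb{N}$, a normed space $X$, an operator $T \in L(X)$ and $r \in \mathbb{N}$ such that $T$ is an $(m,\infty)$-isometry but $T^r$ is not an $(m,\infty)$-isometry.
   Context: $\mathbb{N} = \{1,2,\dots\}$ and $L(X)$ denotes the bounded linear operators from $X$ to $X$. For $m \in \mathbb{N}$, an operator $T \in L(X)$ on a normed space $X$ is called an $(m,\infty)$-isometry if $$\max_{\substack{k=0,\dots,m \\ k \text{ even}}} \lVert T^k x \rVert = \max_{\substack{k=0,\dots,m \\ k \text{ odd}}} \lVert T^k x \rVert \quad \text{for all } x \in X.$$ *)

(* Defs.v *)
From HB Require Import structures.
From mathcomp Require Import all_boot all_order all_algebra.
From mathcomp Require Import all_classical reals topology normedtype.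
From mathcomp Require Import complex.
Set Implicit Arguments.
Unset Strict Implicit.
Unset Printing Implicit Defensive.
Import Order.TTheory GRing.Theory Num.Theory.
Import numFieldNormedType.Exports.
Local Open Scope ring_scope.

Definition bounded_operator (K : numFieldType) (X : normedModType K)
    (T : {linear X -> X}) : Prop :=
  exists M : K, forall x : X, `|T x| <= M * `|x|.

(* The membership of [T] in L(X) is not part of this predicate, so that its
   negation only denies the equality of the two maxima. The starting value 0 of
   the iterated maximum is harmless: norms are nonnegative, and for [0 < m] both
   index sets are nonempty. For [K := R[i]] norms are real elements of [K], hence
   pairwise comparable for its partial order. *)
Definition m_infty_isometry (K : numFieldType) (X : normedModType K) (m : nat)
    (T : X -> X) : Prop :=
  forall x : X,
    \big[Num.max/0]_(0 <= k < m.+1 | ~~ odd k) `|iter k T x| =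
    \big[Num.max/0]_(0 <= k < m.+1 | odd k) `|iter k T x|.

(* Main.v *)
Require Import Defs.
From HB Require Import structures.
From mathcomp Require Import all_boot all_order all_algebra.
From mathcomp Require Import all_classical reals topology normedtype.
From mathcomp Require Import complex.
From mathcomp Require Import prodnormedzmodule.
Import Order.TTheory GRing.Theory Num.Theory.
Import numFieldNormedType.Exports.
Local Open Scope ring_scope.

(** On a weighted sup-norm space with weights [w = (2, 2, 1, 1)], indexed
    cyclically, the cyclic shift [S] satisfies
    [`|S^k x| = max_j w_(j-k) `|x_j|].  Every window of four consecutive weights
    contains a 2 at an even and at an odd place, so [S] is a (3,oo)-isometry;
    but [w_0, w_2, w_4, w_6 = 2, 1, 2, 1] shows that [S^2] is not.  Rescaling the
    coordinates by [w] turns [S] into a weighted shift for the plain sup norm. *)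

Section WeightedShift.
Context (K : numFieldType).

Let X : normedModType K := ((K^o * K^o) * (K^o * K^o))%type.

(** The coefficients 1, 2, 1, 1/2 are the ratios [w_j / w_(j+1)], cyclically; they multiply to 1, so
    the fourth iterate is the identity. *)
Definition wshift (x : X) : X :=
  ((x.1.2, 2 *: x.2.1), (x.2.2, 2^-1 *: x.1.1)).

Fact wshift_is_linear : linear wshift.
Proof.
move=> k [[a b] [c d]] [[a' b'] [c' d']]; rewrite /wshift /=.
by congr ((_, _), (_, _)); rewrite /= !(scalerDr, scalerA) // [k * _]mulrC.
Qed.

HB.instance Definition _ := GRing.isLinear.Build K X X _ wshift wshift_is_linear.

(** The order of [K] may be partial, as for [R[i]]; realness supplies comparability. *)
Lemma real_ge_max (x y z : K) : x \is Num.real -> y \is Num.real ->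
  (Num.max x y <= z) = (x <= z) && (y <= z).
Proof. by move=> xR yR; rewrite comparable_ge_max// real_comparable. Qed.

Lemma norm_quad_le (a b c d : K^o) (z : K) :
  (`|((a, b), (c, d)) : X| <= z) =
  [&& `|a| <= z, `|b| <= z, `|c| <= z & `|d| <= z].
Proof.
by rewrite !prod_normE /= !real_ge_max ?max_real ?normr_real// -!andbA.
Qed.

Lemma normZ2_le (a : K^o) (z : K) : `|2 *: a| <= z -> `|a| <= z.
Proof.
by apply: le_trans; rewrite normrZ normr_nat ler_peMl ?normr_ge0 ?ler1n.
Qed.

Lemma normZ2V_le (a : K^o) (z : K) : `|a| <= z -> `|2^-1 *: a| <= z.
Proof.
by move=> az; apply: normZ2_le; rewrite scalerA divff ?scale1r ?pnatr_eq0.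
Qed.

Lemma wshift_bounded : bounded_operator wshift.
Proof.
exists 2 => -[[a b] [c d]].
have := lexx `|((a, b), (c, d)) : X|; rewrite {1}norm_quad_le.
set z := `|_ : X| => /and4P[az bz cz dz].
have z2 : z <= 2 * z by rewrite ler_peMl ?normr_ge0 ?ler1n.
rewrite norm_quad_le normrZ normr_nat ler_pM2l// cz.
by rewrite (le_trans bz)// (le_trans dz)// (le_trans _ z2)// normZ2V_le.
Qed.

(** Nonnegativity lets the last term absorb the default value 0. *)
Lemma bigmax_even4 (f : nat -> K) : (forall k, 0 <= f k) ->
  \big[Num.max/0]_(0 <= k < 4 | ~~ odd k) f k = Num.max (f 0) (f 2).
Proof. by move=> f0; rewrite unlock /= [Num.max (f 2) 0]max_l. Qed.

Lemma bigmax_odd4 (f : nat -> K) : (forall k, 0 <= f k) ->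
  \big[Num.max/0]_(0 <= k < 4 | odd k) f k = Num.max (f 1) (f 3).
Proof. by move=> f0; rewrite unlock /= [Num.max (f 3) 0]max_l. Qed.

Lemma wshift_isometry : m_infty_isometry 3 wshift.
Proof.
move=> [[a b] [c d]].
rewrite bigmax_even4 ?bigmax_odd4 => [|k|k]; rewrite ?normr_ge0//=.
rewrite /wshift /= !scalerA mulVf ?divff ?pnatr_eq0// !scale1r.
(* By antisymmetry, it suffices that both maxima have the same upper bounds [z]. *)
suff E z : (Num.max `|((a, b), (c, d)) : X|
      `|((2 *: c, 2 *: d), (2^-1 *: a, 2^-1 *: b)) : X| <= z) =
    (Num.max `|((b, 2 *: c), (d, 2^-1 *: a)) : X|
      `|((2 *: d, a), (2^-1 *: b, c)) : X| <= z).
  by apply/le_anti; rewrite E lexx -E lexx.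
rewrite [LHS]real_ge_max ?[RHS]real_ge_max ?normr_real// !norm_quad_le.
(* Either side amounts to bounding [a], [b], [2 *: c] and [2 *: d] by [z]; the other entries are
   halves of these or of smaller ones. *)
apply/andP/andP => -[/and4P[? ? ? ?] /and4P[? ? ? ?]];
  by split; apply/and4P; split; rewrite // ?normZ2_le ?normZ2V_le.
Qed.

Lemma wshift2_not_isometry : ~ m_infty_isometry 3 (iter 2 wshift).
Proof.
(* Along this vector the powers of [iter 2 wshift] have norms 1, 1/2, 1, 1/2, so the even maximum is
   1 and the odd one 1/2. *)
move=> /(_ ((1, 0), (0, 0))).
rewrite bigmax_even4 ?bigmax_odd4 => [|k|k]; rewrite ?normr_ge0//=.
rewrite /wshift /= !scaler0 !scalerA divff ?pnatr_eq0// mulr1 scale1r !maxxx => E.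
have : `|((1, 0), (0, 0)) : X| <= 2^-1.
  rewrite E norm_quad_le normr0 normrZ normr1 mulr1.
  by rewrite ger0_norm ?invr_ge0 ?ler0n ?lexx.
rewrite norm_quad_le normr1 => /and4P[+ _ _ _].
by rewrite invf_ge1 ?ltr0n// lern1.
Qed.

End WeightedShift.

Theorem corollary18 (R : realType) :
  (exists (m : nat) (X : normedModType R) (T : {linear X -> X}) (r : nat),
     [/\ (0 < m)%N, (0 < r)%N, bounded_operator T,
         m_infty_isometry m T & ~ m_infty_isometry m (iter r T)]) /\
  (exists (m : nat) (X : normedModType R[i]) (T : {linear X -> X}) (r : nat),
     [/\ (0 < m)%N, (0 < r)%N, bounded_operator T,
         m_infty_isometry m T & ~ m_infty_isometry m (iter r T)]).
Proof.
(* One construction over any [numFieldType] serves both the real and the complex scalars. *)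
split; exists 3, _, (wshift _), 2; split=> //.
- exact: wshift_bounded.
- exact: wshift_isometry.
- exact: wshift2_not_isometry.
- exact: wshift_bounded.
- exact: wshift_isometry.
- exact: wshift2_not_isometry.
Qed.
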